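(* Every cubical $4$-polytope is strongly $2$-linked; that is, for every set $X$ of five vertices of its graph and every labelling and pairing $\{\{s_1,t_1\},\{s_2,t_2\}\}$ of four of the vertices of $X$, with $x$ the remaining vertex of $X$, there exist vertex-disjoint paths $L_1$ from $s_1$ to $t_1$ and $L_2$ from $s_2$ to $t_2$ in the graph of the polytope, neither of which contains $x$.
   Context: A cubical polytope is a polytope all of whose facets are combinatorially equivalent to cubes. The graph of a polytope consists of its vertices and edges. *)

(* Defs.v *)
From mathcomp Require Import all_boot all_order all_algebra.
From mathcomp Require Import boolp classical_sets functions reals.

Set Implicit Arguments.
Unset Strict Implicit.
Unset Printing Implicit Defensive.

Import Order.TTheory GRing.Theory Num.Theory.

Local Open Scope classical_set_scope.
Local Open Scope ring_scope.

Section Polytope.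
Variables (R : realType) (n : nat).
Implicit Types (P F : set 'rV[R]_n) (s : seq 'rV[R]_n).

Definition conv_hull s : set 'rV[R]_n :=
  [set x | exists a : 'I_(size s) -> R,
    [/\ forall i, 0 <= a i, \sum_i a i = 1 & x = \sum_i a i *: s`_i]].

(* The points p 0, ..., p d of A are affinely independent and their affine
   span contains A; in particular the empty set has no dimension. *)
Definition has_dim (A : set 'rV[R]_n) (d : nat) : Prop :=
  exists p : 'I_d.+1 -> 'rV[R]_n,
    let M := \matrix_(i < d) (p (lift ord0 i) - p ord0) in
    [/\ forall i, A (p i), row_free M
      & forall x, A x -> (x - p ord0 <= M)%MS].

Definition polytope (d : nat) P : Prop :=
  (exists s, P = conv_hull s) /\ has_dim P d.

(* c = 0 is allowed, so that P itself and the empty set are faces of P. *)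
Definition face P F : Prop :=
  exists (c : 'cV[R]_n) (b : R),
    (forall x, P x -> (x *m c) 0 0 <= b) /\
    F = P `&` [set x | (x *m c) 0 0 = b].

Definition facet P F : Prop :=
  exists d, [/\ face P F, has_dim P d.+1 & has_dim F d].

Definition vertex P : set 'rV[R]_n := [set v | face P [set v]].

Definition edge P F : Prop := face P F /\ has_dim F 1.

Definition adjacent P (u v : 'rV[R]_n) : Prop :=
  [/\ u <> v, vertex P u, vertex P v
    & exists E, [/\ edge P E, E u & E v]].

Definition cube : set 'rV[R]_n := [set x | forall i, 0 <= x 0 i <= 1].

End Polytope.

Arguments cube : clear implicits.

(* Isomorphism of the face lattices, as posets ordered by inclusion. *)
Definition comb_equiv (R : realType) (m n : nat)
    (P : set 'rV[R]_m) (Q : set 'rV[R]_n) : Prop :=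
  exists phi : set 'rV[R]_m -> set 'rV[R]_n,
    set_bij (face P) (face Q) phi /\
    forall F G, face P F -> face P G -> (F `<=` G <-> phi F `<=` phi G).

Definition cubical (R : realType) (n : nat) (P : set 'rV[R]_n) : Prop :=
  forall F, facet P F -> exists k, comb_equiv F (cube R k).

Section Graph.
Variables (T : eqType) (V : set T) (E : T -> T -> Prop).

(* L is the sequence of all the vertices of the path, from u to v. *)
Definition graph_path (u v : T) (L : seq T) : Prop :=
  exists2 p, L = u :: p &
    [/\ path (fun x y => `[< E x y >]) u p, last u p = v & uniq L].

Definition strongly_2_linked : Prop :=
  forall X : seq T, uniq X -> size X = 5%N -> (forall v, v \in X -> V v) ->
  forall s1 t1 s2 t2 x, perm_eq X [:: s1; t1; s2; t2; x] ->
  exists L1 L2, [/\ graph_path s1 t1 L1, graph_path s2 t2 L2,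
    ~~ has (mem L1) L2, x \notin L1 & x \notin L2].

End Graph.

(* Main.v *)
Require Import Defs.
From mathcomp Require Import all_boot all_order all_algebra.
From mathcomp Require Import boolp classical_sets functions reals.
From mathcomp Require Import ring lra.

(* Choose a nonconstant affine function f on P vanishing at s1, t1, s2 and x.
   If f changes sign on P, one may assume f t2 <= 0. By the argument of the
   simplex method s1 and t1 are joined by a path whose inner vertices satisfy
   f > 0, and s2 and t2 by a path whose inner vertices satisfy f < 0. If no such
   f changes sign, then s1, t1, s2, x are affinely independent and f = 0 cuts out
   a facet F, whose graph contains that of the 3-cube. Inside F one of the two
   pairs can be joined while avoiding the other points of X, and the other pair
   is joined by a path whose inner vertices lie outside F. *)

Set Implicit Arguments.
Unset Strict Implicit.
Unset Printing Implicit Defensive.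

Import Order.TTheory GRing.Theory Num.Theory.
Local Open Scope classical_set_scope.
Local Open Scope ring_scope.

(** * Affine functions and faces *)

(** Four points span at most three dimensions, so on the 4-dimensional [P] a nonconstant [f]
    vanishing at them exists. The point [t2] can stay free: as an end of a path it may lie on the
    negative side or on [f = 0]. When no such function changes sign, all of them are proportional on
    [P], since two non-proportional ones have a combination with opposite nonzero values at two
    points of [P]. Affine dependence of the four points, or a point of [F] outside their span, would
    yield a second, non-proportional function. A facet of a cubical polytope is equivalent to a cube
    of some unspecified dimension; that this dimension is 3 must be recovered from the face lattice
    alone, through the lengths of chains of faces. *)

Section FiniteSequences.
Variables (R : realType) (T : eqType).
Implicit Types (s : seq T) (f g : T -> R).

Lemma seq_argmax s f : s != [::] ->
  exists2 z0, z0 \in s & forall z, z \in s -> f z <= f z0.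
Proof.
elim: s => // a [|b s] IH _.
  by exists a; rewrite ?mem_head// => z; rewrite inE => /eqP->.
have [//|z0 z0s z0max] := IH.
have [le|/ltW le] := lerP (f a) (f z0).
  by exists z0 => [|z]; rewrite inE ?z0s ?orbT// => /orP[/eqP->//|/z0max].
exists a => [|z]; rewrite inE ?eqxx// => /orP[/eqP->//|/z0max le'].
exact: le_trans le' le.
Qed.

(** A functional that is nonpositive only where [f = 0] becomes nonpositive on all of [s] after
    adding a large multiple of [f]; finitely many points give a finite threshold. *)
Lemma seq_penalty s f g :
  {in s, forall z, f z <= 0} -> {in s, forall z, f z = 0 -> g z <= 0} ->
  exists M, forall M', M <= M' -> {in s, forall z, g z + M' * f z <= 0}.
Proof.
elim: s => [|a s IH] f0 g0; first by exists 0.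
have [z zs|z zs|M MP] := IH; first by apply: f0; rewrite inE zs orbT.
  by apply: g0; rewrite inE zs orbT.
have [fa|fa] := eqVneq (f a) 0.
  exists M => M' /MP h z; rewrite inE => /orP[/eqP->|/h//].
  by rewrite fa mulr0 addr0 g0 ?mem_head.
have fa0 : f a < 0 by rewrite lt_neqAle fa f0 ?mem_head.
exists (Num.max M (g a / - f a)) => M'; rewrite ge_max => /andP[/MP h le] z.
rewrite inE => /orP[/eqP->|/h//].
by move: le; rewrite ler_pdivrMr ?oppr_gt0// mulrN; lra.
Qed.

(** Turns the hyperplane [c = 0] about its face until it meets a further point: [l] is the largest
    ratio [g z / - c z] over the points with [c z < 0], and [z0] attains it. *)
Lemma seq_rotate s c g :
  {in s, forall z, c z <= 0} -> {in s, forall z, c z = 0 -> g z = 0} ->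
  (exists2 z, z \in s & c z < 0) ->
  exists l, {in s, forall z, g z + l * c z <= 0} /\
    exists z0, [/\ z0 \in s, c z0 < 0 & g z0 + l * c z0 = 0].
Proof.
move=> c0 g0 [z1 z1s cz1].
have /(seq_argmax (fun z => g z / - c z)) : [seq z <- s | c z < 0] != [::].
  by rewrite -has_filter; apply/hasP; exists z1.
move=> [z0]; rewrite mem_filter => /andP[cz0 z0s] z0max.
exists (g z0 / - c z0); split; last first.
  by exists z0; split => //; field; rewrite lt_eqF.
move=> z zs; have [cz|cz] := eqVneq (c z) 0.
  by rewrite cz mulr0 addr0 g0.
have cz' : c z < 0 by rewrite lt_neqAle cz c0.
have := z0max z; rewrite mem_filter cz' zs => /(_ isT).
by rewrite ler_pdivrMr ?oppr_gt0// mulrN; lra.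
Qed.

End FiniteSequences.

Section Faces.
Variables (R : realType) (n : nat).
Local Notation V := 'rV[R]_n.
Implicit Types (K F G P : set V) (s : seq V) (f g h : V -> R) (u v x y z : V).

Definition affine f := exists (c : 'cV[R]_n) b, forall x, f x = (x *m c) 0 0 + b.

Lemma affine_comb f g a b :
  affine f -> affine g -> affine (fun x => a * f x + b * g x).
Proof.
move=> [c [d fE]] [c' [d' gE]].
exists (a *: c + b *: c'), (a * d + b * d') => x.
by rewrite fE gE mulmxDr -!scalemxAr !mxE; ring.
Qed.

Lemma affine_cst a : affine (fun=> a).
Proof. by exists 0, a => x; rewrite mulmx0 mxE add0r. Qed.

Lemma affine_opp f : affine f -> affine (fun x => - f x).
Proof.
move=> /(affine_comb (-1) 0) /(_ (affine_cst 0)) [c [b h]].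
by exists c, b => x; rewrite -h; ring.
Qed.

Lemma affine_subC f a : affine f -> affine (fun x => f x - a).
Proof.
move=> /(affine_comb 1 (-1)) /(_ (affine_cst a)) [c [b h]].
by exists c, b => x; rewrite -h; ring.
Qed.

Lemma affine_addM f g a : affine f -> affine g -> affine (fun x => f x + a * g x).
Proof.
move=> /(affine_comb 1 a) af /af [c [b h]].
by exists c, b => x; rewrite -h; ring.
Qed.

Lemma affine_linear (c : 'cV[R]_n) : affine (fun x => (x *m c) 0 0).
Proof. by exists c, 0 => x; rewrite addr0. Qed.

(** The row space of [A] is the set of rows killed by all columns of [cokermx A]; [g] comes from a
    column that detects [w - x0]. *)
Lemma affine_separation m (A : 'M[R]_(m, n)) x0 w : ~~ (w - x0 <= A)%MS ->
  exists g, [/\ affine g, forall y, (y - x0 <= A)%MS -> g y = 0 & g w != 0].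
Proof.
move: (cokermx A) (@submxE _ _ _ _ (w - x0) A) (fun y => @submxE _ _ _ _ (y - x0) A).
move=> C -> AE /matrix0Pn[i [j]]; rewrite ord1 => ne.
exists (fun x => ((x - x0) *m col j C) 0 0); split.
- by exists (col j C), (- (x0 *m col j C) 0 0) => x; rewrite mulmxBl !mxE.
- by move=> y; rewrite AE => /eqP h; rewrite colE mulmxA h mul0mx mxE.
- by rewrite colE mulmxA -colE mxE.
Qed.

Lemma affine_conv k (a : 'I_k -> R) (v : 'I_k -> V) f : affine f ->
  \sum_i a i = 1 -> f (\sum_i a i *: v i) = \sum_i a i * f (v i).
Proof.
move=> [c [b fE]] a1; rewrite fE mulmx_suml summxE -[b in LHS]mul1r -a1 mulr_suml.
rewrite -big_split /=; apply: eq_bigr => i _.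
by rewrite fE -scalemxAl mxE; ring.
Qed.

Definition exposes f K F :=
  [/\ affine f, forall x, K x -> f x <= 0 & F = K `&` [set x | f x = 0]].

Lemma faceP K F : face K F <-> exists f, exposes f K F.
Proof.
split=> [[c [b [le ->]]]|[f [[c [b fE]] le ->]]].
  exists (fun x => (x *m c) 0 0 - b); split=> [|x /le|].
  - exact: (affine_subC b (affine_linear c)).
  - by rewrite subr_le0.
  - apply/seteqP; split=> x /= [Kx h]; split=> //; first by rewrite h subrr.
    by apply/eqP; rewrite -subr_eq0 h.
exists c, (- b); split=> [x /le|]; first by rewrite fE; lra.
apply/seteqP; split=> x /= [Kx h]; split=> //; move: h; rewrite fE; lra.
Qed.

Lemma face_subset K F : face K F -> F `<=` K.
Proof. by move=> [c [b [_ ->]]] x []. Qed.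

Lemma face_refl K : face K K.
Proof.
apply/faceP; exists (fun=> 0); split=> //; first exact: affine_cst.
by apply/seteqP; split=> x // [].
Qed.

Lemma face_set0 K : face K set0.
Proof.
apply/faceP; exists (fun=> - 1); split=> //; first exact: affine_cst.
  by move=> x _; lra.
by apply/seteqP; split=> x //= [_]; lra.
Qed.

Lemma face_sub K F G : face K F -> face K G -> G `<=` F -> face F G.
Proof.
move=> /face_subset FK /faceP[f [af le ->]] GF; apply/faceP; exists f; split=> //.
  by move=> x /FK/le.
apply/seteqP; split=> x /= [h fx]; split=> //; first exact: GF.
exact: FK.
Qed.

(* The support-function form of K = conv_hull s. Unlike the latter it passes
   to faces without reindexing any convex combination. *)
Definition generates s K := (forall z, z \in s -> K z) /\
  forall f, affine f -> {in s, forall z, f z <= 0} -> forall x, K x -> f x <= 0.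

Lemma generates_conv_hull s : generates s (conv_hull s).
Proof.
split=> [z zs|f af le x [a [a0 a1 ->]]]; last first.
  rewrite affine_conv//; apply: sumr_le0 => i _.
  by rewrite mulr_ge0_le0// le// mem_nth.
have zi : (index z s < size s)%N by rewrite index_mem.
exists (fun i => (i == Ordinal zi)%:R); split=> [i||].
- exact: ler0n.
- by rewrite (bigD1 (Ordinal zi))//= eqxx big1 ?addr0// => i /negPf->.
- rewrite (bigD1 (Ordinal zi))//= eqxx big1 ?addr0 ?scale1r ?nth_index//.
  by move=> i /negPf->; rewrite scale0r.
Qed.

Lemma generates_eq0 s K f : generates s K -> affine f ->
  {in s, forall z, f z = 0} -> forall x, K x -> f x = 0.
Proof.
move=> [_ sK] af f0 x Kx; apply/eqP; rewrite eq_le; apply/andP; split.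
  by apply: (sK _ af) => // z /f0->.
rewrite -oppr_le0; apply: (sK _ (affine_opp af)) => // z /f0->.
by rewrite oppr0.
Qed.

Lemma generates_argmax s K f : generates s K -> K !=set0 -> affine f ->
  exists2 z0, z0 \in s & forall x, K x -> f x <= f z0.
Proof.
move=> [sK leK] [x0 Kx0] af.
have : s != [::].
  (* With no generators the constant 1 would be vacuously nonpositive on [s], hence on [K]. *)
  apply/eqP => s0; have := leK _ (affine_cst 1) _ _ Kx0.
  by rewrite s0 => /(_ (fun z zs => False_ind _ (Bool.diff_false_true zs))); lra.
move=> /(seq_argmax f)[z0 z0s z0max]; exists z0 => // x Kx.
rewrite -subr_le0; apply: (leK _ (affine_subC (f z0) af)) => // z /z0max.
by rewrite subr_le0.
Qed.

(** A penalty extends the bound on [h] from the generators in [F] to all of [s], and the penalty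
    vanishes on [F]. *)
Lemma generates_face s K F : generates s K -> face K F ->
  generates [seq z <- s | `[< F z >]] F.
Proof.
move=> [sK leK] /faceP[f [af f0 FE]]; split=> [z|h ah h0 x].
  by rewrite mem_filter => /andP[/asboolP].
have [z zs|z zs fz|M /(_ M (lexx _)) MP] := @seq_penalty R _ s f h.
- exact/f0/sK.
- apply: h0; rewrite mem_filter zs andbT; apply/asboolP.
  by rewrite FE; split=> //; exact: sK.
rewrite {1}FE => -[Kx /= fx].
by have := leK _ (affine_addM M ah af) MP x Kx; rewrite fx mulr0 addr0.
Qed.

Lemma face_trans s K F G : generates s K -> face K F -> face F G -> face K G.
Proof.
move=> [sK leK] /faceP[f [af f0 FE]] /faceP[g [ag g0 GE]].
have [z zs|z zs fz|M MP] := @seq_penalty R _ s f g.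
- exact/f0/sK.
- by apply: g0; rewrite FE; split=> //; exact: sK.
have leM M' : M <= M' -> forall x, K x -> g x + M' * f x <= 0.
  by move=> le; apply: leK; [exact: affine_addM|exact: MP].
(* [M] already makes the sum nonpositive on [K]; the extra 1 forces [f x = 0] wherever the new sum
   vanishes. *)
apply/faceP; exists (fun x => g x + (M + 1) * f x); split.
- exact: affine_addM.
- by apply: leM; rewrite lerDl.
apply/seteqP; split=> x /=.
  by rewrite GE FE => -[[Kx /= ->] /= ->]; split=> //; ring.
move=> [Kx h]; have hM := leM M (lexx _) x Kx; have fx := f0 x Kx.
have fx0 : f x = 0 by lra.
by rewrite GE FE; split; [split|move: h => /=; rewrite fx0; lra].
Qed.

(** If no generator were lost, the functional exposing [F] would vanish on [s] and so on [K]. This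
    is the measure for inductions over faces. *)
Lemma size_filter_face s K F : generates s K -> face K F -> F <> K ->
  (size [seq z <- s | `[< F z >]] < size s)%N.
Proof.
move=> gK /faceP[f [af f0 FE]] neq.
rewrite ltn_neqAle size_filter count_size andbT -all_count; apply/negP => sF.
apply: neq; rewrite FE; apply/seteqP; split=> [x [] //|x Kx]; split=> //=.
apply: (generates_eq0 gK af) => // z /(allP sF)/asboolP.
by rewrite FE => -[].
Qed.

Lemma argmax_face K f z : affine f -> K z -> (forall x, K x -> f x <= f z) ->
  face K (K `&` [set x | f x = f z]).
Proof.
move=> af Kz le; apply/faceP; exists (fun x => f x - f z); split.
- exact: affine_subC.
- by move=> x /le; rewrite subr_le0.
- apply/seteqP; split=> x /= [Kx]; first by move->; rewrite subrr.
  by move=> /eqP; rewrite subr_eq0 => /eqP.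
Qed.

Lemma nneg_face K f : affine f -> (forall x, K x -> 0 <= f x) ->
  face K (K `&` [set x | f x = 0]).
Proof.
move=> af f0; apply/faceP; exists (fun x => - f x); split.
- exact: affine_opp.
- by move=> x /f0; rewrite oppr_le0.
- by apply/seteqP; split=> x [Kx /= fx]; split=> //=; lra.
Qed.

(** A coordinate in which two points of [K] differ attains its maximum on a proper face, which has
    fewer generators. *)
Lemma exists_vertex s K : generates s K -> K !=set0 -> exists v, vertex K v.
Proof.
have [m] := ubnP (size s); elim: m s K => // m IH s K sm gK [x Kx].
have [[y Ky yx]|nK] := pselect (exists2 y, K y & y <> x); last first.
  exists x; rewrite /vertex /=; suff <- : K = [set x] by exact: face_refl.
  apply/seteqP; split=> [y Ky|_ -> //]; apply: contrapT => yx.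
  by apply: nK; exists y.
have [i nei] : exists i, y 0 i <> x 0 i.
  apply/not_existsP => h; apply: yx; apply/rowP => i.
  by have /contrapT := h i.
have af : affine (fun z : V => z 0 i).
  by exists (delta_mx i 0), 0 => z; rewrite -colE mxE addr0.
have [z zs zmax] := generates_argmax gK (ex_intro _ x Kx) af.
have Kz := gK.1 z zs.
have fF := argmax_face af Kz zmax.
set F := _ `&` _ in fF.
have neF : F <> K.
  move=> FE; have [[_ /= fx] [_ /= fy]] : F x /\ F y by rewrite FE.
  by apply: nei; rewrite fx fy.
have gF := generates_face gK fF.
have [||v vF] := IH _ F _ gF.
- by rewrite -ltnS (leq_trans _ sm)// ltnS (size_filter_face gK).
- by exists z; split.
by exists v; exact: face_trans gK fF vF.
Qed.

Lemma vertex_mem_generators s K v : generates s K -> vertex K v -> v \in s.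
Proof.
move=> gK vK; have := generates_face gK vK => gv.
have [|z zs _] := generates_argmax gv _ (affine_cst 0); first by exists v.
have := gv.1 z zs; move=> <-; move: zs; rewrite mem_filter.
by case/andP.
Qed.

End Faces.

(** * Edges and connectivity *)

Lemma count_strict (T : eqType) (a b : pred T) (s : seq T) x :
  subpred a b -> x \in s -> b x -> ~~ a x -> (count a s < count b s)%N.
Proof.
move=> ab; elim: s => //= y s IH; rewrite inE => /orP[/eqP<-|xs] bx nax.
  by rewrite bx (negPf nax) add0n add1n ltnS sub_count.
have ayb : (a y <= b y)%N by case: (a y) (ab y) => // ->.
by rewrite -addnS leq_add// IH.
Qed.

Section Edges.
Variables (R : realType) (n : nat).
Local Notation V := 'rV[R]_n.
Implicit Types (K F G P : set V) (s : seq V) (f g h : V -> R) (u v x y z : V).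

(** Climbs from [G] by at most one dimension. If some [w] of [K] leaves the span of [A] and [x - v],
    a functional [g] that is zero on this span but not at [w] tilts the one exposing [G] to a face
    [K1] strictly above [G]. As [K1] cannot contain both [x] and [w], it has fewer generators, and
    [z0] takes the role of [x]. *)
Lemma face_cover s K G v m (A : 'M[R]_(m, n)) x :
  generates s K -> face K G -> G v -> (forall y, G y -> (y - v <= A)%MS) ->
  K x -> ~ G x ->
  exists K' x', [/\ face K K', G `<=` K', K' x', ~ G x'
    & forall y, K' y -> (y - v <= A + (x' - v))%MS].
Proof.
have [k] := ubnP (size s); elim: k s K x => // k IH s K x sk gK fG Gv GA Kx nGx.
have [KA|/existsNP[w /not_implyP[Kw /negP nwA]]] :=
    pselect (forall y, K y -> (y - v <= A + (x - v))%MS).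
  by exists K, x; split=> //; [exact: face_refl|exact: face_subset].
have [g [ag gA gw]] := affine_separation nwA.
have g0 y : G y -> g y = 0.
  by move=> /GA yA; apply: gA; exact: submx_trans yA (addsmxSl _ _).
have gx : g x = 0 by apply: gA; exact: addsmxSr.
have [f [af f0 GE]] := (faceP K G).1 fG.
have inG y : K y -> f y = 0 -> G y by rewrite GE.
have fx : f x < 0.
  by rewrite lt_neqAle f0// andbT; apply/eqP => fx; exact/nGx/inG.
have [z /gK.1/f0//|z /gK.1 Kz /(inG _ Kz)/g0//||l [hl [z0 [z0s fz0 hz0]]]] :=
  @seq_rotate R _ s f g.
  apply: contrapT => nz; suff fx0 : f x = 0 by rewrite fx0 ltxx in fx.
  apply: (generates_eq0 gK) => // z zs; apply: contrapT => /eqP fz; apply: nz.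
  by exists z => //; rewrite lt_neqAle fz f0//; exact: gK.1.
have ah := affine_addM l ag af.
have h0 := gK.2 _ ah hl.
set K1 := K `&` [set y | g y + l * f y = 0].
have fK1 : face K K1 by apply/faceP; exists (fun y => g y + l * f y).
have GK1 : G `<=` K1.
  move=> y Gy; split; first exact: face_subset fG _ Gy.
  by move: (Gy); rewrite GE => -[_ /= ->]; rewrite g0// mulr0 addr0.
have K1K : K1 <> K.
  move=> E; have [_ /= hx] : K1 x by rewrite E.
  have [_ /= hw] : K1 w by rewrite E.
  move/eqP: hx; rewrite gx add0r mulf_eq0 (lt_eqF fx) orbF => /eqP l0.
  by move: hw gw; rewrite l0 mul0r addr0 => ->; rewrite eqxx.
have K1z0 : K1 z0 by split=> //; exact: gK.1.
have nGz0 : ~ G z0 by rewrite GE => -[_ /= E]; move: fz0; rewrite E ltxx.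
have sk1 := leq_trans (size_filter_face gK fK1 K1K) sk.
have [K' [x' [fK' GK' K'x' nGx' K'A]]] :=
  IH _ K1 z0 sk1 (generates_face gK fK1) (face_sub fK1 fG GK1) Gv GA K1z0 nGz0.
by exists K', x'; split=> //; exact: face_trans gK fK1 fK'.
Qed.

Lemma adjacent_face s K F u v :
  generates s K -> face K F -> adjacent F u v -> adjacent K u v.
Proof.
move=> gK fF [uv vu vv [E [[fE dE] Eu Ev]]].
split=> //; [exact: face_trans gK fF vu|exact: face_trans gK fF vv|].
by exists E; split=> //; split=> //; exact: face_trans gK fF fE.
Qed.

(** The face that [face_cover] finds above [[set v]] lies on a line through [v], so it is an edge;
    the other end is where the functional exposing [v] is least. *)
Lemma exists_adjacent s K v x : generates s K -> vertex K v -> K x -> x <> v ->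
  exists u, adjacent K v u.
Proof.
move=> gK vK Kx xv.
have [||E [y [fE vE Ey /= yv EA]]] :=
    @face_cover s K [set v] v n (0 : 'M_n) x gK vK erefl _ Kx.
- by move=> _ ->; rewrite subrr sub0mx.
- by [].
have Ev : E v := vE v erefl.
have gE := generates_face gK fE.
have vertE : vertex E v by apply: face_sub fE vK vE.
have [f [af f0 vf]] := (faceP E [set v]).1 vertE.
have fv : f v = 0 by have : [set v] v by []; rewrite vf => -[].
have fy : f y < 0.
  rewrite lt_neqAle f0// andbT; apply/eqP => fy; apply: yv.
  by have : (E `&` [set x | f x = 0]) y by []; rewrite -vf.
have aNf := affine_opp af.
have [z0 z0s z0max] := generates_argmax gE (ex_intro _ v Ev) aNf.
have Ez0 := gE.1 z0 z0s.
have fF := argmax_face aNf Ez0 z0max.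
have [|u uF] := exists_vertex (generates_face gE fF); first by exists z0.
have [Eu /= /oppr_inj fu] := face_subset uF (erefl u).
have uv : v <> u.
  by move=> uv; have := z0max _ Ey; rewrite -fu -uv fv; lra.
exists u; split=> //.
  exact: face_trans gK fE (face_trans gE fF uF).
exists E; split=> //; split=> //.
exists (fun i => if i == ord0 then v else y); set M := \matrix_i _.
have ME : M = y - v by apply/matrixP => i j; rewrite mxE ord1 /= mxE.
split=> [i||w Ew].
- by case: ifP.
- rewrite ME /row_free rank_rV; apply/eqP; case: eqP => // /eqP.
  by rewrite subr_eq0 => /eqP/yv.
- by rewrite ME; have := EA w Ew; rewrite adds0mx.
Qed.

Lemma adjacent_sym K u v : adjacent K u v -> adjacent K v u.
Proof.
by move=> [uv vu vv [E [eE Eu Ev]]]; split=> //; [exact: nesym|exists E].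
Qed.

(* Tilt f by the functional exposing v until v becomes a maximum that is not
   unique: every other point of the new face is then f-greater than v. *)
Lemma exists_increasing_adjacent s K v f x : generates s K -> vertex K v ->
  affine f -> K x -> f v < f x -> exists2 u, adjacent K v u & f v < f u.
Proof.
move=> gK vK af Kx fvx.
have [c [ac c0 vE]] := (faceP K [set v]).1 vK.
have Kv : K v := face_subset vK (erefl v).
have isv y : K y -> c y = 0 -> y = v.
  by move=> Ky cy; have : (K `&` [set x | c x = 0]) y by []; rewrite -vE.
have cv : c v = 0 by have : [set v] v by []; rewrite vE => -[].
have xv : x <> v by move=> xv; move: fvx; rewrite xv ltxx.
have cx : c x < 0.
  by rewrite lt_neqAle c0// andbT; apply/eqP => cx; exact/xv/isv.
have [z /gK.1/c0//|z /gK.1 Kz /(isv _ Kz)->||l [hl [z0 [z0s cz0 hz0]]]] :=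
  @seq_rotate R _ s c (fun y => f y - f v).
- by rewrite subrr.
- apply: contrapT => nz; suff cx0 : c x = 0 by rewrite cx0 ltxx in cx.
  apply: (generates_eq0 gK) => // z zs; apply: contrapT => /eqP cz; apply: nz.
  by exists z => //; rewrite lt_neqAle cz c0//; exact: gK.1.
have ah := affine_addM l (affine_subC (f v) af) ac.
have h0 := gK.2 _ ah hl.
(* At [x] the term [f x - f v] is positive and [c x] is negative, so the tilted functional can be
   nonpositive only if [l] is positive. *)
have l0 : 0 < l.
  rewrite ltNge; apply/negP => l0; have := h0 x Kx.
  have : 0 <= l * c x by rewrite mulr_le0// ltW.
  by lra.
set K1 := K `&` [set y | f y - f v + l * c y = 0].
have fK1 : face K K1 by apply/faceP; exists (fun y => f y - f v + l * c y).
have K1v : K1 v by split=> //=; rewrite cv; ring.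
have K1z0 : K1 z0 by split=> //; exact: gK.1.
have z0v : z0 <> v by move=> E; move: cz0; rewrite E cv ltxx.
have vK1 : vertex K1 v by apply: face_sub fK1 vK _ => _ ->.
have [u vu] := exists_adjacent (generates_face gK fK1) vK1 K1z0 z0v.
exists u; first exact: adjacent_face gK fK1 vu.
have [uv _ /face_subset/(_ u erefl)[Ku /= hu] _] := vu.
have cu : c u < 0.
  by rewrite lt_neqAle c0// andbT; apply/eqP => cu; apply/uv; rewrite (isv u).
have : l * c u < 0 by rewrite pmulr_rlt0.
by lra.
Qed.

Definition connected_in K (S : set V) u v :=
  exists p, [/\ path (fun x y => `[< adjacent K x y >]) u p, last u p = v
    & forall z, z \in u :: p -> S z].

Lemma connected_in_refl K (S : set V) u : S u -> connected_in K S u u.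
Proof. by move=> Su; exists [::]; split=> // z; rewrite inE => /eqP->. Qed.

Lemma connected_in_step K (S : set V) u v :
  S u -> S v -> adjacent K u v -> connected_in K S u v.
Proof.
move=> Su Sv uv; exists [:: v]; split=> //=; first by rewrite andbT; apply/asboolP.
by move=> z; rewrite !inE => /orP[]/eqP->.
Qed.

Lemma connected_in_trans K (S : set V) u v w :
  connected_in K S u v -> connected_in K S v w -> connected_in K S u w.
Proof.
move=> [p [pp lp Sp]] [q [pq lq Sq]]; exists (p ++ q); split.
- by rewrite cat_path pp lp.
- by rewrite last_cat lp.
- move=> z; rewrite -cat_cons mem_cat => /orP[/Sp//|zq].
  by apply: Sq; rewrite inE zq orbT.
Qed.

Lemma connected_in_sym K (S : set V) u v :
  connected_in K S u v -> connected_in K S v u.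
Proof.
move=> [p [pp lp Sp]]; elim: p u pp lp Sp => [|w p IH] u /= pp lp Sp.
  by rewrite -lp; exists [::].
move: pp => /andP[/asboolP uw pp].
have Swp z : z \in w :: p -> S z by move=> h; apply: Sp; rewrite inE h orbT.
apply: connected_in_trans (IH w pp lp Swp) _.
apply: connected_in_step; last exact: adjacent_sym.
  by apply: Swp; rewrite mem_head.
by apply: Sp; rewrite mem_head.
Qed.

Lemma connected_in_sub K (S S' : set V) u v :
  S `<=` S' -> connected_in K S u v -> connected_in K S' u v.
Proof. by move=> SS [p [pp lp Sp]]; exists p; split=> // z /Sp/SS. Qed.

(** Each step to a higher neighbour lowers the number of generators above the current vertex, and
    uniqueness of the maximum [w] provides such a step from every other vertex. *)
Lemma connected_in_climb s K h u w : generates s K -> affine h ->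
  (forall x, K x -> x <> w -> h x < h w) -> vertex K w -> vertex K u ->
  connected_in K [set z | h u <= h z] u w.
Proof.
move=> gK ah wmax vw.
have [m] := ubnP (count (fun z => h u < h z) s).
elim: m u => // m IH u um vu.
have [->|/eqP uw] := eqVneq u w; first by apply: connected_in_refl => /=.
have Kw : K w := face_subset vw (erefl w).
have Ku : K u := face_subset vu (erefl u).
have [u' uu' hu] := exists_increasing_adjacent gK vu ah Kw (wmax u Ku uw).
have vu' : vertex K u' by case: uu'.
apply: (@connected_in_trans _ _ _ u').
  by apply: connected_in_step => //=; exact: ltW.
apply: connected_in_sub (IH u' _ vu'); first by move=> z /=; exact/le_trans/ltW.
rewrite -ltnS; apply: leq_trans um; rewrite ltnS.
have u's := vertex_mem_generators gK vu'.
apply: (count_strict _ u's) => // [z|]; last by rewrite ltxx.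
exact: lt_trans.
Qed.

Lemma connected_in_pos s K f u v : generates s K -> affine f ->
  vertex K u -> vertex K v -> 0 < f u -> 0 < f v ->
  connected_in K [set z | 0 < f z] u v.
Proof.
move=> gK af vu vv fu fv.
have Ku : K u := face_subset vu (erefl u).
have [z0 z0s z0max] := generates_argmax gK (ex_intro _ u Ku) af.
have Kz0 := gK.1 z0 z0s.
have fF := argmax_face af Kz0 z0max.
have [|w wF] := exists_vertex (generates_face gK fF); first by exists z0.
have [Kw /= fw] := face_subset wF (erefl w).
have vw : vertex K w := face_trans gK fF wF.
have [g [ag g0 wE]] := (faceP K [set w]).1 vw.
have gw : g w = 0 by have : [set w] w by []; rewrite wE => -[].
(* For every e > 0, w is the only maximum of f + e g. *)
suff toW y : vertex K y -> 0 < f y -> connected_in K [set z | 0 < f z] y w.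
  exact: connected_in_trans (toW u vu fu) (connected_in_sym (toW v vv fv)).
move=> vy fy; have Ky : K y := face_subset vy (erefl y).
(* [e] solves [f y + e * g y = e], so the perturbed function is positive at the start [y]; on the
   path [f] is at least as large, because [g <= 0] on [K]. *)
have gy := g0 y Ky; pose e := f y / (1 - g y).
have e0 : 0 < e by rewrite divr_gt0//; lra.
have hy : 0 < f y + e * g y.
  have -> : f y + e * g y = e by rewrite /e; field; lra.
  by [].
have [p [pp lp hp]] : connected_in K [set z | f y + e * g y <= f z + e * g z] y w.
  apply: (connected_in_climb gK) => //; first exact: affine_addM.
  move=> x Kx xw; rewrite gw mulr0 addr0.
  have fx := z0max x Kx; have gx : g x < 0.
    rewrite lt_neqAle g0// andbT; apply/eqP => gx; apply: xw.
    by have : (K `&` [set x | g x = 0]) x by []; rewrite -wE.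
  have : e * g x < 0 by rewrite pmulr_rlt0.
  by lra.
exists p; split=> // z zp /=; have := hp z zp => /= hz.
have Kz : K z.
  have {}hp : forall z, z \in y :: p -> K z.
    elim: (p) (y) vy pp => [|b q IH] a va /=.
      by move=> _ x; rewrite inE => /eqP->; exact: face_subset va _ erefl.
    move=> /andP[/asboolP ab pq] x; rewrite inE => /orP[/eqP->|].
      exact: face_subset va _ erefl.
    by apply: IH => //; case: ab.
  exact: hp.
have : e * g z <= 0 by apply: mulr_ge0_le0; [exact: ltW|exact: g0].
by lra.
Qed.

(** An end with [f = 0] first moves to a neighbour with [f > 0], which exists because [f x] is
    positive; the rest of the path stays positive. *)
Lemma connected_in_nneg s K f u v x : generates s K -> affine f ->
  vertex K u -> vertex K v -> 0 <= f u -> 0 <= f v -> K x -> 0 < f x ->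
  connected_in K [set z | 0 < f z \/ z = u \/ z = v] u v.
Proof.
move=> gK af vu vv fu fv Kx fx.
have up y : vertex K y -> 0 <= f y ->
    exists z, [/\ vertex K z, 0 < f z & connected_in K [set z | 0 < f z \/ z = y] y z].
  move=> vy; rewrite le_eqVlt => /orP[/eqP fy|fy]; last first.
    by exists y; split=> //; apply: connected_in_refl; left.
  have [|z yz fz] := exists_increasing_adjacent gK vy af Kx; first by rewrite -fy.
  rewrite -fy in fz; exists z; split=> //; first by case: yz.
  by apply: connected_in_step => //=; [right|left].
have [u' [vu' fu' uu']] := up u vu fu.
have [v' [vv' fv' vv'']] := up v vv fv.
apply: (@connected_in_trans _ _ _ u').
  by apply: connected_in_sub uu' => z /= [|->]; tauto.
apply: (@connected_in_trans _ _ _ v').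
  by apply: connected_in_sub (connected_in_pos gK af vu' vv' fu' fv') => z; left.
by apply/connected_in_sym/(connected_in_sub _ vv'') => z /= [|->]; tauto.
Qed.

End Edges.

(** * Dimension and face isomorphisms *)

Section Chains.
Variables (R : realType) (n : nat).
Local Notation V := 'rV[R]_n.
Implicit Types (K F G P : set V) (s : seq V) (u v x y z : V).

(** Faces of the lattice carry no dimension, but the largest possible [j] recovers it. Chains start
    at a nonempty face, so that a single vertex counts as 0. *)
Inductive face_chain K : nat -> set V -> Prop :=
| face_chain0 G : face K G -> G !=set0 -> face_chain K 0 G
| face_chainS j G G' : face_chain K j G -> face K G' -> G `<=` G' ->
    ~ G' `<=` G -> face_chain K j.+1 G'.

Lemma face_chain_face K j G : face_chain K j G -> face K G /\ G !=set0.
Proof.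
elim=> // {}j {}G G' _ [_ [x Gx]] ? GG' _; split=> //.
by exists x; exact: GG'.
Qed.

Lemma has_dim_span K d : has_dim K d -> exists M : 'M[R]_(d, n),
  [/\ row_free M, forall x y, K x -> K y -> (x - y <= M)%MS
    & forall m (A : 'M[R]_(m, n)) q, (forall x, K x -> (x - q <= A)%MS) ->
        (M <= A)%MS].
Proof.
move=> [p]; set M := \matrix_i _ => -[pK fM KM]; exists M; split=> //.
  move=> x y Kx Ky; have -> : x - y = (x - p ord0) - (y - p ord0).
    by rewrite opprB addrA subrK.
  by rewrite addmx_sub ?eqmx_opp ?KM.
move=> m A q KA; apply/row_subP => i; rewrite rowK.
have -> : p (lift ord0 i) - p ord0 = (p (lift ord0 i) - q) - (p ord0 - q).
  by rewrite opprB addrA subrK.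
by rewrite addmx_sub ?eqmx_opp ?KA.
Qed.

(** [A] holds directions within the affine hull of [G], expressed by saying that every functional
    constant on [G] kills [A]. A point [x] of [G'] outside [G] gives a direction outside [A], for
    otherwise the functional exposing [G] would place [x] in [G]. *)
Lemma face_chain_leq_dim K d j G : has_dim K d -> face_chain K j G -> (j <= d)%N.
Proof.
move=> /has_dim_span[M [_ KM _]] jG.
suff [A [jA AM _]] : exists A : 'M[R]_n, [/\ (j <= \rank A)%N, (A <= M)%MS &
    forall (c : 'cV_n) b, (forall y, G y -> (y *m c) 0 0 = b) -> A *m c = 0].
  exact: leq_trans (leq_trans jA (mxrankS AM)) (rank_leq_row M).
elim: jG => [{}G fG _|{}j {}G G' cG [A [jA AM Ac]] fG' GG' nG'G].
  by exists 0; split; [|exact: sub0mx|move=> c b _; exact: mul0mx].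
have [fG [q Gq]] := face_chain_face cG.
have /existsNP[x /not_implyP[G'x nGx]] := nG'G.
have Kx := face_subset fG' G'x; have Kq := face_subset fG Gq.
exists (A + (x - q))%MS; split.
- apply: leq_ltn_trans jA (rank_ltmx _).
  rewrite ltmxE addsmxSl /=; apply/negP => /(submx_trans (addsmxSr _ _)) /submxP[D xq].
  have [c [b [_ GE]]] := fG.
  have qc : (q *m c) 0 0 = b by move: Gq; rewrite GE => -[].
  apply: nGx; rewrite GE; split=> //=.
  rewrite -(subrK q x) xq mulmxDl -mulmxA (Ac c b) ?mulmx0 ?add0r//.
  by move=> y; rewrite GE => -[].
- by rewrite addsmx_sub AM KM.
- move=> c b G'c; apply/sub_kermxP; rewrite addsmx_sub.
  apply/andP; split; apply/sub_kermxP.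
    by apply: (Ac c b) => y /GG'/G'c.
  apply/matrixP => i k; rewrite !ord1 mulmxBl.
  have -> : x *m c = q *m c.
    by apply/matrixP => i' k'; rewrite !ord1 (G'c x)// (G'c q)//; exact: GG'.
  by rewrite subrr.
Qed.

(** Repeating [face_cover] from a vertex raises the rank bound by one per step, so before step [d]
    the face is not yet all of [K]. *)
Lemma exists_face_chain s K d :
  generates s K -> has_dim K d -> exists G, face_chain K d G.
Proof.
move=> gK dK; have [M [fM KM MA]] := has_dim_span dK.
have [v vK] : exists v, vertex K v.
  by apply: (exists_vertex gK); case: dK => p [pK _ _]; exists (p ord0).
suff H j : (j <= d)%N -> exists G (A : 'M[R]_n),
    [/\ face_chain K j G, G v, forall x, G x -> (x - v <= A)%MS & (\rank A <= j)%N].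
  by have [G [A []]] := H d (leqnn d); exists G.
elim: j => [_|j IH jd].
  exists [set v], 0; split=> //; last by rewrite mxrank0.
  - by apply: face_chain0 => //; exists v.
  - by move=> x ->; rewrite subrr sub0mx.
have [G [A [cG Gv GA rA]]] := IH (ltnW jd).
have [x Kx nGx] : exists2 x, K x & ~ G x.
  apply: contrapT => nx; have /MA/mxrankS : forall x, K x -> (x - v <= A)%MS.
    by move=> x Kx; apply: GA; apply: contrapT => nGx; apply: nx; exists x.
  by rewrite (eqP fM) leqNgt (leq_ltn_trans rA).
have fG := (face_chain_face cG).1.
have [K' [x' [fK' GK' K'x' nGx' K'A]]] := face_cover gK fG Gv GA Kx nGx.
exists K', (A + (x' - v))%MS; split=> //; last 1 first.
- rewrite (leq_trans (mxrank_adds_leqif _ _))// -[j.+1]addn1 leq_add//.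
  exact: rank_leq_row.
- by apply: face_chainS cG fK' GK' _ => /(_ _ K'x').
- exact: GK'.
Qed.

(** Inside [G] the vertex [u] has a neighbour, which can only be [v]. Adjacency is thus read off
    from incidences, which face isomorphisms preserve. *)
Lemma adjacent_of_face s K G u v : generates s K -> vertex K u -> vertex K v ->
  u <> v -> face K G -> G u -> G v ->
  (forall z, vertex K z -> G z -> z = u \/ z = v) -> adjacent K u v.
Proof.
move=> gK vu vv uv fG Gu Gv Guv.
have gG := generates_face gK fG.
have vGu : vertex G u by apply: face_sub fG vu _ => _ ->.
have [z uz] := exists_adjacent gG vGu Gv (nesym uv).
have [uz' _ vz _] := uz.
have [zu|<-] := Guv z (face_trans gK fG vz) (face_subset vz (erefl z)).
  by rewrite zu in uz'.
exact: adjacent_face gK fG uz.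
Qed.

End Chains.

(** * Isomorphisms of face lattices *)

Section FaceIsomorphisms.
Variables (R : realType) (m n : nat) (P : set 'rV[R]_m) (Q : set 'rV[R]_n).

Lemma comb_equiv_sym : comb_equiv P Q -> comb_equiv Q P.
Proof.
move=> [phi [[pf pi ps] mono]].
pose psi G := xget set0 [set F | face P F /\ phi F = G].
have psiP G : face Q G -> face P (psi G) /\ phi (psi G) = G.
  move=> /ps[F fF FG]; rewrite /psi; case: xgetP => [x -> []//|/(_ F)].
  by case; split.
exists psi; split; first split.
- by move=> G /psiP[].
- by move=> G G' /set_mem/psiP[_ {2}<-] /set_mem/psiP[_ {2}<-] ->.
- move=> F fF; exists (phi F); first exact: pf.
  have [f1 e] := psiP _ (pf _ fF).
  by apply: pi; rewrite ?inE.
- move=> F G /psiP[fF eF] /psiP[fG eG].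
  by rewrite (mono _ _ fF fG) eF eG.
Qed.

Variable phi : set 'rV[R]_m -> set 'rV[R]_n.
Hypothesis phi_bij : set_bij (face P) (face Q) phi.
Hypothesis phi_mono :
  forall F G, face P F -> face P G -> (F `<=` G <-> phi F `<=` phi G).

Lemma iso_face F : face P F -> face Q (phi F).
Proof. by case: phi_bij => pf _ _; exact: pf. Qed.

Lemma iso_surj G : face Q G -> exists2 F, face P F & phi F = G.
Proof. by case: phi_bij => _ _ ps /ps. Qed.

(** Emptiness is order-theoretic: the empty set is the least face on both sides. *)
Lemma iso_nonempty F : face P F -> phi F !=set0 <-> F !=set0.
Proof.
move=> fF; split=> [[y Fy]|[x Fx]]; apply/set0P/negP => /eqP F0.
  have [F' fF' E] := iso_surj (face_set0 Q).
  suff : phi F `<=` phi F' by rewrite E => /(_ _ Fy).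
  by apply/phi_mono => //; rewrite F0.
suff : F `<=` set0 by move=> /(_ _ Fx).
by apply/phi_mono => //; [exact: face_set0|rewrite F0].
Qed.

Lemma iso_face_chain j G : face_chain P j G -> face_chain Q j (phi G).
Proof.
elim=> [{}G fG G0|{}j {}G G' cG IH fG' GG' nG'G].
  by apply: face_chain0; [exact: iso_face|exact/iso_nonempty].
have fG := (face_chain_face cG).1.
apply: face_chainS IH (iso_face fG') _ _; first exact/phi_mono.
by move=> /phi_mono h; apply: nG'G; exact: h.
Qed.

(** Vertices are the minimal nonempty faces: a vertex of [phi [set v]] pulls back to a nonempty face
    inside [[set v]]. *)
Lemma iso_vertex t v : generates t Q -> vertex P v ->
  exists2 w, vertex Q w & phi [set v] = [set w].
Proof.
move=> gQ vv; have fv := iso_face vv.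
have [|w wv] := exists_vertex (generates_face gQ fv).
  by apply/iso_nonempty => //; exists v.
exists w; first exact: face_trans gQ fv wv.
have [F fF Fw] := iso_surj (face_trans gQ fv wv).
have Fv : F `<=` [set v] by apply/phi_mono => //; rewrite Fw; exact: face_subset wv.
have [y Fy] : F !=set0 by apply/iso_nonempty => //; rewrite Fw; exists w.
suff <- : F = [set v] by [].
by apply/seteqP; split=> // _ ->; rewrite -(Fv y Fy).
Qed.

Lemma iso_vertex_surj s t w : generates s P -> generates t Q -> vertex Q w ->
  exists2 v, vertex P v & phi [set v] = [set w].
Proof.
move=> gP gQ vw; have [F fF Fw] := iso_surj vw.
have [|v vF] := exists_vertex (generates_face gP fF).
  by apply/iso_nonempty => //; rewrite Fw; exists w.
have vv := face_trans gP fF vF; exists v => //.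
have [w' _ vw'] := iso_vertex gQ vv.
have : phi [set v] `<=` phi F by apply/phi_mono => //; exact: face_subset vF.
by rewrite vw' Fw => /(_ w' erefl) ->.
Qed.

Lemma iso_adjacent s t G u v u' v' : generates s P -> generates t Q ->
  vertex P u -> vertex P v -> u <> v -> face P G -> G u -> G v ->
  (forall z, vertex P z -> G z -> z = u \/ z = v) ->
  phi [set u] = [set u'] -> phi [set v] = [set v'] -> adjacent Q u' v'.
Proof.
move=> gP gQ vu vv uv fG Gu Gv Guv uu' vv'.
have mem z z' : vertex P z -> phi [set z] = [set z'] -> G z <-> phi G z'.
  move=> vz zz'; split=> [Gz|Gz'].
    suff : phi [set z] `<=` phi G by rewrite zz'; apply.
    by apply/phi_mono => // _ ->.
  suff : [set z] `<=` G by apply.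
  by apply/phi_mono => //; rewrite zz' => _ ->.
have set1_inj (x y : 'rV[R]_n) : [set x] = [set y] -> x = y.
  by move=> E; have : [set x] x by []; rewrite E.
apply: (adjacent_of_face gQ _ _ _ (iso_face fG)).
- by rewrite /vertex /= -uu'; exact: iso_face.
- by rewrite /vertex /= -vv'; exact: iso_face.
- move=> E; apply: uv; rewrite E -vv' in uu'.
  have : [set u] `<=` [set v] by apply/phi_mono => //; rewrite uu'.
  exact.
- exact: (mem u u' vu uu').1.
- exact: (mem v v' vv vv').1.
move=> z' vz' Gz'; have [z vz zz'] := iso_vertex_surj gP gQ vz'.
have [zu|zv] := Guv z vz ((mem z z' vz zz').2 Gz').
  by left; apply: set1_inj; rewrite -zz' zu.
by right; apply: set1_inj; rewrite -zz' zv.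
Qed.

End FaceIsomorphisms.

Lemma comb_equiv_dim (R : realType) m n (P : set 'rV[R]_m) (Q : set 'rV[R]_n)
    s d e : generates s P -> comb_equiv P Q -> has_dim P d -> has_dim Q e ->
  (d <= e)%N.
Proof.
move=> gP [phi [bij mono]] dP dQ; have [G cG] := exists_face_chain gP dP.
exact: face_chain_leq_dim dQ (iso_face_chain bij mono cG).
Qed.

(** * The unit cube and its faces *)

Section Cube.
Variables (R : realType) (k : nat).
Implicit Types (w : {ffun 'I_k -> bool}) (D : pred 'I_k).

Definition cube_point w : 'rV[R]_k := \row_i (w i)%:R.

Definition cube_points := [seq cube_point w | w <- enum {: {ffun 'I_k -> bool}}].

Lemma cube_point_inj : injective cube_point.
Proof.
move=> w w' /rowP E; apply/ffunP => i; have := E i; rewrite !mxE => /eqP.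
by rewrite eqr_nat; case: (w i); case: (w' i).
Qed.

Lemma cube_point_in w : cube R k (cube_point w).
Proof. by move=> i; rewrite mxE; case: (w i); rewrite ler01 lexx. Qed.

(** An affine function on the cube is largest at the corner with 1 exactly where its coefficient is
    positive. *)
Lemma generates_cube : generates cube_points (cube R k).
Proof.
split=> [z /mapP[w _ ->]|f [c [b fE]] f0 x x01]; first exact: cube_point_in.
pose w : {ffun 'I_k -> bool} := [ffun i => 0 < c i 0].
apply: le_trans (f0 (cube_point w) _); last by apply: map_f; rewrite mem_enum.
rewrite !fE lerD2r !mxE; apply: ler_sum => i _; rewrite mxE ffunE.
have /andP[x0 x1] := x01 i; case: ltrP => ci; first by rewrite ler_pM2r.
by rewrite mul0r mulr_ge0_le0.
Qed.

Lemma has_dim_cube : has_dim (cube R k) k.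
Proof.
exists (fun i => if unlift ord0 i is Some j then delta_mx 0 j else 0).
set M := \matrix_i _; have -> : M = 1%:M.
  apply/row_matrixP => i; rewrite rowK row1 liftK.
  by case: unliftP => [j /eqP|_]; rewrite ?subr0//; rewrite -val_eqE.
split=> [i j||x _]; rewrite ?row_free_unit ?unitmx1 ?submx1//.
case: unliftP => [i' _|_]; rewrite mxE ?lexx ?ler01//.
by case: (j == i'); rewrite /= lexx ler01.
Qed.

Lemma cube_face w D :
  face (cube R k) (cube R k `&` [set x | forall i, D i -> x 0 i = cube_point w 0 i]).
Proof.
(* In each fixed coordinate the sign points towards the value of the corner, so the deficit is a sum
   of nonnegative terms and vanishes only if all fixed coordinates agree. *)
pose c : 'cV[R]_k := \col_i (if D i then if w i then 1 else -1 else 0).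
have tm x i : cube R k x -> 0 <= (cube_point w 0 i - x 0 i) * c i 0.
  move=> /(_ i)/andP[x0 x1]; rewrite !mxE.
  by case: (D i); [case: (w i)|]; rewrite /= ?mulr1n ?mulr0n; lra.
have E x : (cube_point w *m c) 0 0 - (x *m c) 0 0 =
    \sum_i (cube_point w 0 i - x 0 i) * c i 0.
  by rewrite [X in X - _]mxE [X in _ - X]mxE -sumrB; apply: eq_bigr => i _; ring.
exists c, ((cube_point w *m c) 0 0); split=> [x x01|].
  by rewrite -subr_ge0 E sumr_ge0// => i _; exact: tm.
apply/seteqP; split=> x /= [x01 h]; split=> //.
  apply/eqP; rewrite eq_sym -subr_eq0 E big1// => i _.
  by case: (boolP (D i)) => [/h->|nD]; [ring|rewrite [c i 0]mxE (negPf nD) mulr0].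
move=> i Di; have /eqP : (cube_point w *m c) 0 0 - (x *m c) 0 0 = 0 by rewrite h subrr.
rewrite E psumr_eq0 => [|j _]; last exact: tm.
move=> /allP/(_ i (mem_index_enum _)) /=; rewrite mulf_eq0 [c i 0]mxE Di.
by rewrite subr_eq0 => /orP[/eqP//|]; case: (w i); rewrite ?oppr_eq0 oner_eq0.
Qed.

Lemma cube_vertex w : vertex (cube R k) (cube_point w).
Proof.
rewrite /vertex /=; suff -> : [set cube_point w] =
    cube R k `&` [set x | forall i, predT i -> x 0 i = cube_point w 0 i].
  exact: cube_face.
apply/seteqP; split=> [_ ->|x [_ h]]; first by split=> //; exact: cube_point_in.
by apply/rowP => i; exact: h.
Qed.

Lemma cube_vertexE x : vertex (cube R k) x -> exists w, x = cube_point w.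
Proof. by move=> /(vertex_mem_generators generates_cube)/mapP[w _ ->]; exists w. Qed.

End Cube.

(** * The graph of a 3-dimensional cubical facet *)

Definition cube_adj (t t' : bool * bool * bool) : bool :=
  ((t.1.1 != t'.1.1) + (t.1.2 != t'.1.2) + (t.2 != t'.2) == 1)%N.

Definition bool3 : seq (bool * bool * bool) :=
  [:: (true, true, true); (true, true, false); (true, false, true);
      (true, false, false); (false, true, true); (false, true, false);
      (false, false, true); (false, false, false)].

Lemma mem_bool3 t : t \in bool3.
Proof. by case: t => [[[] []] []]. Qed.

(* Nested conditionals instead of && keep call-by-value evaluation from
   exploring every branch of this search. *)
Fixpoint reach m (av : seq (bool * bool * bool)) a b : bool :=
  (a == b) || (if m is m'.+1 then
    has (fun c => if cube_adj a c then
                    if c \in a :: av then false else reach m' (a :: av) c b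
                  else false) bool3
  else false).

Lemma reach_path m av a b : reach m av a b -> a \notin av ->
  exists p, [/\ path cube_adj a p, last a p = b & all (fun c => c \notin av) (a :: p)].
Proof.
elim: m av a => [|m IH] av a; last rewrite -[reach _ _ _ _]/((a == b) ||
  has (fun c => if cube_adj a c then
    if c \in a :: av then false else reach m (a :: av) c b else false) bool3).
all: move=> /orP[/eqP->|] //.
- by move=> h; exists [::]; rewrite /= h.
- by move=> h; exists [::]; rewrite /= h.
move=> /hasP[c _]; case: ifP => // ac; case: ifPn => // cav.
move=> /IH/(_ cav)[p [pp lp /allP ap]] aav.
exists (c :: p); split=> //; first by rewrite /= ac.
apply/allP => z; rewrite inE => /orP[/eqP->//|/ap].
by rewrite inE negb_or => /andP[].
Qed.

(** Fuel 6 is ample: without two vertices only six remain, and a path through them has at most five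
    edges. *)
Lemma cube_3_connected a b c d :
  uniq [:: a; b; c; d] -> reach 6 [:: c; d] a b.
Proof.
have /allP/(_ a (mem_bool3 a))/allP/(_ b (mem_bool3 b))/allP/(_ c (mem_bool3 c))
    /allP/(_ d (mem_bool3 d)) :
  all (fun a => all (fun b => all (fun c => all (fun d =>
    if uniq [:: a; b; c; d] then reach 6 [:: c; d] a b else true)
    bool3) bool3) bool3) bool3.
  by vm_compute.
by case: ifP.
Qed.

(* A 3-element vertex cut of the 3-cube is the neighbourhood of a vertex. If
   both triples were such cuts, the cube would contain a triangle. *)
Lemma cube_one_pair_linked a b c d x : uniq [:: a; b; c; d; x] ->
  reach 6 [:: c; d; x] a b || reach 6 [:: a; b; x] c d.
Proof.
have /allP/(_ a (mem_bool3 a))/allP/(_ b (mem_bool3 b))/allP/(_ c (mem_bool3 c))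
    /allP/(_ d (mem_bool3 d))/allP/(_ x (mem_bool3 x)) :
  all (fun a => all (fun b => all (fun c => all (fun d => all (fun x =>
    if uniq [:: a; b; c; d; x] then
      reach 6 [:: c; d; x] a b || reach 6 [:: a; b; x] c d
    else true) bool3) bool3) bool3) bool3) bool3.
  by vm_compute.
by case: ifP.
Qed.

Definition coords (t : bool * bool * bool) : seq bool := [:: t.1.1; t.1.2; t.2].

(** Presents an edge as the corners that agree with [t] off one coordinate, the form in which
    [cube_face] makes it a face. *)
Lemma cube_adj_line t t' : cube_adj t t' ->
  exists2 k, (k < 3)%N & forall t0,
    (forall j, (j < 3)%N -> j != k -> nth false (coords t0) j = nth false (coords t) j)
      <-> t0 = t \/ t0 = t'.
Proof.
move=> tt'; have : has (fun k => all (fun t0 =>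
    all (fun j => (j != k) ==> (nth false (coords t0) j == nth false (coords t) j))
      (iota 0 3) == (t0 == t) || (t0 == t')) bool3) (iota 0 3).
  by case: t t' tt' => [[[] []] []] [[[] []] []].
move=> /hasP[k]; rewrite mem_iota => /andP[_ k3] /allP kP; exists k => // t0.
have /eqP E := kP t0 (mem_bool3 t0).
split=> [h|tt0].
  have : (t0 == t) || (t0 == t').
    rewrite -E; apply/allP => j; rewrite mem_iota => /andP[_ j3].
    by apply/implyP => jk; apply/eqP; exact: h.
  by case/orP => /eqP; [left|right].
have : (t0 == t) || (t0 == t') by case: tt0 => ->; rewrite eqxx ?orbT.
rewrite -E => /allP h j j3 jk; apply/eqP; apply: (implyP (h j _)) => //.
by rewrite mem_iota.
Qed.

Definition cube3_vertex (R : realType) (t : bool * bool * bool) : 'rV[R]_3 :=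
  cube_point R [ffun i : 'I_3 => nth false (coords t) i].

Lemma vertex_cube3 (R : realType) t : vertex (cube R 3) (cube3_vertex R t).
Proof. exact: cube_vertex. Qed.

Lemma cube3_vertexE (R : realType) x :
  vertex (cube R 3) x -> exists t, x = cube3_vertex R t.
Proof.
move=> /cube_vertexE[w ->]; exists (w (inord 0), w (inord 1), w (inord 2)).
congr cube_point; apply/ffunP => -[[|[|[|//]]] lt]; rewrite ffunE /=;
  by congr (w _); apply/val_inj; rewrite /= inordK.
Qed.

Lemma cube3_vertex_inj (R : realType) : injective (cube3_vertex R).
Proof.
move=> [[a b] c] [[a' b'] c'] /cube_point_inj/ffunP E.
have := E (inord 0); have := E (inord 1); have := E (inord 2).
by rewrite !ffunE /= !inordK//= => -> -> ->.
Qed.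

(** * Transfer of the cube graph to a facet *)

Section CubeFacets.
Variables (R : realType) (n : nat) (P F : set 'rV[R]_n) (s : seq 'rV[R]_n).
Hypotheses (gP : generates s P) (fF : face P F) (cF : comb_equiv F (cube R 3)).

(** The isomorphism is taken from the cube to [F]: [theta] labels the vertices of [F] by triples,
    and an edge of the cube becomes a face of [F] with exactly two vertices. *)
Lemma cube3_facet_graph : exists theta : bool * bool * bool -> 'rV[R]_n,
  [/\ forall t, F (theta t), forall v, vertex P v -> F v -> exists t, v = theta t,
      injective theta
    & forall t t', cube_adj t t' -> adjacent P (theta t) (theta t')].
Proof.
have [phi [bij mono]] := comb_equiv_sym cF.
have gF := generates_face gP fF.
have gC := generates_cube R 3.
have ex t : exists v, vertex F v /\ phi [set cube3_vertex R t] = [set v].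
  by have [v] := iso_vertex bij mono gF (vertex_cube3 R t); exists v.
have [theta thP] := choice ex; exists theta; split.
- by move=> t; have [/face_subset/(_ _ erefl)] := thP t.
- move=> v vv Fv; have vFv : vertex F v by apply: face_sub fF vv _ => _ ->.
  have [y /cube3_vertexE[t ->] ty] := iso_vertex_surj bij mono gC gF vFv.
  exists t; have [_] := thP t; rewrite ty => /seteqP[/(_ v erefl)//].
  move=> t t' tt'; have [_ e] := thP t; have [_ e'] := thP t'.
  apply: (@cube3_vertex_inj R).
  have : [set cube3_vertex R t] `<=` [set cube3_vertex R t'].
    by apply/mono; [exact: vertex_cube3|exact: vertex_cube3|rewrite e e' tt'].
  by apply.
move=> t t' tt'; apply: adjacent_face gP fF _.
have [i ti] : exists i : 'I_3, forall t0, (forall j, predC1 i j ->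
    cube3_vertex R t0 0 j = cube3_vertex R t 0 j) <-> t0 = t \/ t0 = t'.
  have [k k3 kP] := cube_adj_line tt'; exists (Ordinal k3) => t0.
  apply: iff_trans (kP t0); split=> h j.
    move=> j3 jk; have := h (Ordinal j3) jk; rewrite !mxE !ffunE /= => /eqP.
    by rewrite eqr_nat; do 2!case: nth.
  by move=> jk; rewrite !mxE !ffunE h.
pose G := cube R 3 `&` [set x | forall j, predC1 i j -> x 0 j = cube3_vertex R t 0 j].
have memG t0 : t0 = t \/ t0 = t' -> G (cube3_vertex R t0).
  by move=> /ti h; split=> //; exact: cube_point_in.
have fG : face (cube R 3) G.
  exact: (@cube_face R 3 [ffun j : 'I_3 => nth false (coords t) j] (predC1 i)).
apply: (iso_adjacent bij mono gC gF (vertex_cube3 R t) (vertex_cube3 R t') _ fG _ _ _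
  (thP t).2 (thP t').2).
- by move=> /cube3_vertex_inj E; move: tt'; rewrite E /cube_adj !eqxx.
- exact: (memG t (or_introl erefl)).
- exact: (memG t' (or_intror erefl)).
- move=> z /cube3_vertexE[t0 ->] [_ /= /ti[]->]; [by left|by right].
Qed.

Definition avoiding (av : seq 'rV[R]_n) : set 'rV[R]_n := F `&` [set z | z \notin av].

Lemma connected_avoiding theta av a b :
  (forall t, F (theta t)) ->
  (forall t t', cube_adj t t' -> adjacent P (theta t) (theta t')) ->
  injective theta -> a \notin av -> reach 6 av a b ->
  connected_in P (avoiding (map theta av)) (theta a) (theta b).
Proof.
move=> thF thA inj nav /reach_path/(_ nav)[p [pp lp /allP ap]].
exists (map theta p); split.
- rewrite path_map; apply: sub_path pp => t t' /thA h; exact/asboolP.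
- by rewrite last_map lp.
- move=> z; rewrite -map_cons => /mapP[t /ap tav ->]; split=> //=.
  by rewrite mem_map.
Qed.

Lemma cube_facet_connected a b c d :
  {in [:: a; b; c; d], forall v, vertex P v /\ F v} -> uniq [:: a; b; c; d] ->
  connected_in P (avoiding [:: c; d]) a b.
Proof.
have [theta [thF thS thI thA]] := cube3_facet_graph => vF.
have pre v : v \in [:: a; b; c; d] -> exists t, v = theta t.
  by move=> /vF[]; exact: thS.
have [a' ea] := pre a ltac:(by rewrite !inE eqxx ?orbT).
have [b' eb] := pre b ltac:(by rewrite !inE eqxx ?orbT).
have [c' ec] := pre c ltac:(by rewrite !inE eqxx ?orbT).
have [d' ed] := pre d ltac:(by rewrite !inE eqxx ?orbT).
rewrite ea eb ec ed -[[:: _; _; _; _]]/(map theta [:: a'; b'; c'; d']) map_inj_uniq//.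
move=> u; apply: (@connected_avoiding theta [:: c'; d']) => //.
  by move: u; rewrite /= !inE !negb_or => /andP[/and3P[_ -> ->]].
exact: cube_3_connected.
Qed.

Lemma cube_facet_linked a b c d x :
  {in [:: a; b; c; d; x], forall v, vertex P v /\ F v} -> uniq [:: a; b; c; d; x] ->
  connected_in P (avoiding [:: c; d; x]) a b \/
  connected_in P (avoiding [:: a; b; x]) c d.
Proof.
have [theta [thF thS thI thA]] := cube3_facet_graph => vF.
have pre v : v \in [:: a; b; c; d; x] -> exists t, v = theta t.
  by move=> /vF[]; exact: thS.
have [a' ea] := pre a ltac:(by rewrite !inE eqxx ?orbT).
have [b' eb] := pre b ltac:(by rewrite !inE eqxx ?orbT).
have [c' ec] := pre c ltac:(by rewrite !inE eqxx ?orbT).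
have [d' ed] := pre d ltac:(by rewrite !inE eqxx ?orbT).
have [x' ex] := pre x ltac:(by rewrite !inE eqxx ?orbT).
rewrite ea eb ec ed ex -[[:: _; _; _; _; _]]/(map theta [:: a'; b'; c'; d'; x']).
rewrite map_inj_uniq// => u; have /orP[] := cube_one_pair_linked u.
  move=> r; left; apply: (@connected_avoiding theta [:: c'; d'; x']) => //.
  by move: u; rewrite /= !inE !negb_or => /andP[/and4P[_ -> -> ->]].
move=> r; right; apply: (@connected_avoiding theta [:: a'; b'; x']) => //.
move: u; rewrite /= !inE !negb_or !(eq_sym c').
by case/and5P=> /and4P[_ -> _ _] /and3P[-> _ _] /andP[_ ->].
Qed.

End CubeFacets.

(** * Linkedness *)

Section Linked.
Variables (R : realType) (n : nat) (P : set 'rV[R]_n) (s : seq 'rV[R]_n).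
Hypothesis gP : generates s P.
Implicit Types (S : set 'rV[R]_n) (u v x : 'rV[R]_n) (f g : 'rV[R]_n -> R).

Lemma connected_in_graph_path S u v : connected_in P S u v ->
  exists L, graph_path (adjacent P) u v L /\ forall z, z \in L -> S z.
Proof.
move=> [p [pp lp Sp]]; move: lp; case: (shortenP pp) => q pq uq sub lq.
exists (u :: q); split; first by exists q.
move=> z; rewrite inE => /orP[zu|/sub zq]; apply: Sp; rewrite inE.
  by rewrite zu.
by rewrite zq orbT.
Qed.

Definition linked_avoiding x s1 t1 s2 t2 := exists L1 L2,
  [/\ graph_path (adjacent P) s1 t1 L1, graph_path (adjacent P) s2 t2 L2,
    ~~ has (mem L1) L2, x \notin L1 & x \notin L2].

Lemma linked_of_connected S1 S2 x s1 t1 s2 t2 :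
  connected_in P S1 s1 t1 -> connected_in P S2 s2 t2 ->
  (forall z, S1 z -> ~ S2 z) -> ~ S1 x -> ~ S2 x ->
  linked_avoiding x s1 t1 s2 t2.
Proof.
move=> /connected_in_graph_path[L1 [p1 L1S]] /connected_in_graph_path[L2 [p2 L2S]].
move=> S12 xS1 xS2; exists L1, L2; split=> //.
- by apply/hasPn => z /L2S h2; apply/negP => /L1S/S12.
- by apply/negP => /L1S.
- by apply/negP => /L2S.
Qed.

Variables (s1 t1 s2 t2 x : 'rV[R]_n).
Hypothesis uX : uniq [:: s1; t1; s2; t2; x].
Hypothesis vX : {in [:: s1; t1; s2; t2; x], forall v, vertex P v}.

(** Indexed by ['I_4] so that these points can themselves witness [has_dim F 3]. *)
Let base (i : 'I_4) : 'rV[R]_n := nth 0 [:: s1; t1; s2; x] i.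

Lemma base_vertex i : vertex P (base i).
Proof.
by case: i => [[|[|[|[|//]]]] lt]; apply: vX; rewrite /base /= !inE eqxx ?orbT.
Qed.

Lemma base_eq0 f : (forall i, f (base i) = 0) ->
  [/\ f s1 = 0, f t1 = 0, f s2 = 0 & f x = 0].
Proof.
move=> f0; have h k (k4 : (k < 4)%N) := f0 (Ordinal k4).
split; [exact: (h 0%N isT)|exact: (h 1%N isT)|exact: (h 2%N isT)|exact: (h 3%N isT)].
Qed.

(** A common vertex of the two paths would need both signs of [f] or be an end, and the signs at the
    ends exclude this; [x] is avoided because [f x = 0] and [x] is no end. *)
Lemma linked_of_crossing f y z : affine f -> (forall i, f (base i) = 0) ->
  P y -> P z -> 0 < f y -> f z < 0 -> linked_avoiding x s1 t1 s2 t2.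
Proof.
wlog ft2 : f y z / f t2 <= 0.
  move=> W af f0 Py Pz fy fz; have [h|/ltW h] := lerP (f t2) 0; first exact: (W f y z).
  apply: (W (fun v => - f v) z y) => //; rewrite ?oppr_le0 ?oppr_gt0 ?oppr_lt0//.
  - exact: affine_opp.
  - by move=> i; rewrite f0 oppr0.
move=> af f0 Py Pz fy fz; have [fs1 ft1 fs2 fx] := base_eq0 f0.
have vin v : v \in [:: s1; t1; s2; t2; x] -> vertex P v := @vX v.
have vs1 := vin s1 ltac:(by rewrite !inE eqxx ?orbT).
have vt1 := vin t1 ltac:(by rewrite !inE eqxx ?orbT).
have vs2 := vin s2 ltac:(by rewrite !inE eqxx ?orbT).
have vt2 := vin t2 ltac:(by rewrite !inE eqxx ?orbT).
have c1 : connected_in P [set z | 0 < f z \/ z = s1 \/ z = t1] s1 t1.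
  by apply: (connected_in_nneg gP af vs1 vt1 _ _ Py fy); rewrite ?fs1 ?ft1.
have c2 : connected_in P [set z | 0 < - f z \/ z = s2 \/ z = t2] s2 t2.
  apply: (connected_in_nneg gP (affine_opp af) vs2 vt2 _ _ Pz) => //.
  - by rewrite fs2 oppr0.
  - by rewrite oppr_ge0.
  - by rewrite oppr_gt0.
move: uX; rewrite /= !inE !negb_or.
move=> /and5P[/and4P[/eqP n1 /eqP n2 /eqP n3 /eqP n4]
  /and3P[/eqP n5 /eqP n6 /eqP n7] /andP[/eqP n8 /eqP n9] /eqP n10 _].
apply: (linked_of_connected c1 c2) => /=.
- move=> w [fw|ew] [fw'|ew'].
  + by lra.
  + by case: ew' => ew'; rewrite ew' in fw; lra.
  + by case: ew => ew; rewrite ew in fw'; lra.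
  + by case: ew ew' => -> []; congruence.
- by rewrite fx ltxx; case=> [//|[h|h]]; congruence.
- by rewrite fx oppr0 ltxx; case=> [//|[h|h]]; congruence.
Qed.

Lemma linked_of_cubical_facet f y : affine f -> (forall i, f (base i) = 0) ->
  (forall v, P v -> 0 <= f v) -> P y -> 0 < f y ->
  comb_equiv (P `&` [set v | f v = 0]) (cube R 3) -> linked_avoiding x s1 t1 s2 t2.
Proof.
move=> af f0 fge Py fy; set F := P `&` _ => cF.
have fF : face P F := nneg_face af fge.
have [fs1 ft1 fs2 fx] := base_eq0 f0.
have vin v : v \in [:: s1; t1; s2; t2; x] -> vertex P v := @vX v.
have vs1 := vin s1 ltac:(by rewrite !inE eqxx ?orbT).
have vt1 := vin t1 ltac:(by rewrite !inE eqxx ?orbT).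
have vs2 := vin s2 ltac:(by rewrite !inE eqxx ?orbT).
have vt2 := vin t2 ltac:(by rewrite !inE eqxx ?orbT).
have vx := vin x ltac:(by rewrite !inE eqxx ?orbT).
have inF v : vertex P v -> f v = 0 -> vertex P v /\ F v.
  by move=> vv fv; split=> //; split=> //; exact: face_subset vv _ erefl.
have off u v : vertex P u -> vertex P v ->
    connected_in P [set z | 0 < f z \/ z = u \/ z = v] u v.
  move=> vu vv; apply: (connected_in_nneg gP af vu vv _ _ Py fy); apply: fge.
    exact: face_subset vu _ erefl.
  exact: face_subset vv _ erefl.
have avoidP av z : avoiding F av z -> f z = 0 /\ z \notin av by move=> [[]].
move: (uX); rewrite /= !inE !negb_or.
move=> /and5P[/and4P[n1 n2 n3 n4] /and3P[n5 n6 n7] /andP[n8 n9] n10 _].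
have [ft2|ft2] := eqVneq (f t2) 0.
  have vF : {in [:: s1; t1; s2; t2; x], forall v, vertex P v /\ F v}.
    by move=> v; rewrite !inE => /or4P[|||/orP[]] /eqP->; exact: inF.
  have [c|c] := cube_facet_linked gP fF cF vF uX.
    apply: (linked_of_connected c (off s2 t2 vs2 vt2)).
    - move=> z /avoidP[fz zn] [/= h|E]; first by rewrite fz ltxx in h.
      by move: zn; case: E => ->; rewrite !inE eqxx ?orbT.
    - by move=> /avoidP[_]; rewrite !inE eqxx !orbT.
    - by rewrite /= fx ltxx => -[//|[E|E]]; [rewrite E eqxx in n9|rewrite E eqxx in n10].
  apply: (linked_of_connected (off s1 t1 vs1 vt1) c).
  - move=> z h /avoidP[fz zn]; case: h => [/= h|E]; first by rewrite fz ltxx in h.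
    by move: zn; case: E => ->; rewrite !inE eqxx ?orbT.
  - by rewrite /= fx ltxx => -[//|[E|E]]; [rewrite E eqxx in n4|rewrite E eqxx in n7].
  - by move=> /avoidP[_]; rewrite !inE eqxx !orbT.
(* Now [t2] is off [F], so a path from [s1] to [t1] in [F] has only [s2] and [x] to avoid, which
   3-connectivity of the cube allows. *)
have vF : {in [:: s1; t1; s2; x], forall v, vertex P v /\ F v}.
  by move=> v; rewrite !inE => /or4P[] /eqP->; exact: inF.
have u4 : uniq [:: s1; t1; s2; x] by rewrite /= !inE !negb_or n1 n2 n4 n5 n7 n9.
apply: (linked_of_connected (cube_facet_connected gP fF cF vF u4) (off s2 t2 vs2 vt2)).
- move=> z /avoidP[fz zn] /= [|[E|E]]; first by rewrite fz ltxx.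
    by rewrite E !inE eqxx in zn.
  by rewrite -E fz eqxx in ft2.
- by move=> /avoidP[_]; rewrite !inE eqxx !orbT.
- by rewrite /= fx ltxx => -[//|[E|E]]; [rewrite E eqxx in n9|rewrite E eqxx in n10].
Qed.

Lemma linked_of_cubical : has_dim P 4 -> cubical P -> linked_avoiding x s1 t1 s2 t2.
Proof.
move=> dP cubP.
have [[f [y [z [af f0 Py Pz [fy fz]]]]]|nocross] := pselect (exists f y z,
    [/\ affine f, forall i, f (base i) = 0, P y, P z & 0 < f y /\ f z < 0]).
  exact: (linked_of_crossing af f0 Py Pz fy fz).
pose D := \matrix_(i < 3) (base (lift ord0 i) - base ord0).
have Pbase i : P (base i) := face_subset (base_vertex i) erefl.
have baseD i : (base i - base ord0 <= D)%MS.
  have [j ->|->] := unliftP ord0 i; last by rewrite subrr sub0mx.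
  by have := row_sub j D; rewrite rowK.
have [M [fM KM MA]] := has_dim_span dP.
have indep f g y z : affine f -> affine g -> (forall i, f (base i) = 0) ->
    (forall i, g (base i) = 0) -> P y -> P z -> f y * g z = f z * g y.
  move=> af ag f0 g0 Py Pz; apply: contrapT => /eqP ne.
  (* The coefficients make [h y] the determinant [f y * g z - f z * g y] and [h z] its negative, a
     crossing unless it is 0. *)
  pose h v := (g z + g y) * f v + (- (f z + f y)) * g v.
  have ah : affine h by exact: affine_comb.
  have h0 i : h (base i) = 0 by rewrite /h f0 g0; ring.
  have hy : h y = f y * g z - f z * g y by rewrite /h; ring.
  have hz : h z = - (f y * g z - f z * g y) by rewrite /h; ring.
  move: ne; rewrite -subr_eq0 -hy neq_lt => /orP[lt|lt]; apply: nocross.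
    by exists h, z, y; split=> //; rewrite hz -hy oppr_gt0.
  by exists h, y, z; split=> //; rewrite hz -hy oppr_lt0.
have outside m (A : 'M[R]_(m, n)) : (\rank A <= 3)%N ->
    exists2 w, P w & ~~ (w - base ord0 <= A)%MS.
  move=> rA; apply: contrapT => nw.
  have /MA/mxrankS : forall w, P w -> (w - base ord0 <= A)%MS.
    by move=> w Pw; apply/negPn/negP => h; apply: nw; exists w.
  by rewrite (eqP fM) leqNgt ltnS rA.
have [z Pz nz] := outside _ D (rank_leq_row D).
have [f [af f0 fz]] : exists f, [/\ affine f, forall i, f (base i) = 0 & 0 < f z].
  have [g [ag gD gz]] := affine_separation nz.
  have [gz0|gz0] := ltrP (g z) 0; [exists (fun v => - g v)|exists g]; split.
  - exact: affine_opp.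
  - by move=> i; rewrite gD ?oppr0.
  - by rewrite oppr_gt0.
  - by [].
  - by move=> i; exact: gD.
  - by rewrite lt_neqAle eq_sym gz.
have fge v : P v -> 0 <= f v.
  by move=> Pv; rewrite leNgt; apply/negP => fv; apply: nocross; exists f, z, v.
pose F := P `&` [set v | f v = 0].
have dF : has_dim F 3.
  exists base; split=> [i||y [Py /= fy]]; first by split=> //; exact: Pbase.
    rewrite -/D -[_ D]negbK; apply/negP => nfree.
    (* If [D] had rank at most 2, adding the direction of [z] would leave room for a [g] that
       vanishes at [z] but not on [P], hence is not proportional to [f]. *)
    have rD : (\rank D < 3)%N by rewrite ltn_neqAle nfree rank_leq_row.
    have [|w Pw nw] := outside _ (D + (z - base ord0))%MS.
      apply: (leq_trans (mxrank_adds_leqif _ _)).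
      by rewrite -[leqRHS]/(2 + 1)%N leq_add// rank_leq_row.
    have [g [ag gD gw]] := affine_separation nw.
    have gz : g z = 0 by apply: gD; exact: addsmxSr.
    have g0 i : g (base i) = 0.
      by apply: gD; exact: submx_trans (baseD i) (addsmxSl _ _).
    have /eqP := indep f g w z af ag f0 g0 Pw Pz.
    by rewrite gz mulr0 eq_sym mulf_eq0 (gt_eqF fz) (negPf gw).
  (* Likewise, a point [y] of [F] outside the span gives a [g] with [g y] nonzero although
     [f y = 0]. *)
  apply/negPn/negP => ny; have [g [ag gD gy]] := affine_separation ny.
  have g0 i : g (base i) = 0 by apply: gD; exact: baseD.
  have /eqP := indep f g y z af ag f0 g0 Py Pz.
  by rewrite fy mul0r eq_sym mulf_eq0 (gt_eqF fz) (negPf gy).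
have fF : face P F := nneg_face af fge.
have [k cF] := cubP F (ex_intro _ 3%N (And3 fF dP dF)).
(* A maximal chain of faces is carried over by the equivalence in both directions, which gives the
   two inequalities between [k] and 3. *)
have k3 : k = 3%N.
  have gF := generates_face gP fF; have dC := has_dim_cube R k.
  apply/eqP; rewrite eqn_leq (comb_equiv_dim gF cF dF dC).
  by rewrite (comb_equiv_dim (generates_cube R k) (comb_equiv_sym cF) dC dF).
rewrite k3 in cF.
exact: (linked_of_cubical_facet af f0 fge Pz fz cF).
Qed.

End Linked.

Theorem theorem27 (R : realType) (n : nat) (P : set 'rV[R]_n) :
  polytope 4 P -> cubical P -> strongly_2_linked (vertex P) (adjacent P).
Proof.
move=> [[s PE] dP] cP X uX _ vX s1 t1 s2 t2 x pX.
have gP : generates s P by rewrite PE; exact: generates_conv_hull.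
apply: (linked_of_cubical gP) => //; first by rewrite -(perm_uniq pX).
by move=> v; rewrite -(perm_mem pX); exact: vX.
Qed.
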